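(* Let $\mathbf{R}$ be a finite commutative unital ring. Then $$U(\mathcal{H}_{\mathbf{R}})=\{ q=w+xi+yj+zk \in \mathcal{H}_{\mathbf{R}} \mid q^{s}=1 \text{ for some positive integer } s \},$$ and, for $q=w+xi+yj+zk\in\mathcal{H}_{\mathbf{R}}$, the powers $q^{s}$ can be computed by the following recurrence: $q^{s}=q_{s}+q_{s}'i+q_{s}''j+q_{s}'''k$, where for $s\ge 2$ $$\begin{pmatrix} q_{s} \\ q_{s}' \\ q_{s}'' \\ q_{s}''' \end{pmatrix} = \begin{pmatrix} w & -x & -y& -z \\ x & w & z & -y \\ y & -z & w & x \\ z & y & -x & w \end{pmatrix} \begin{pmatrix} q_{s-1} \\ q_{s-1}' \\ q_{s-1}'' \\ q_{s-1}''' \end{pmatrix}, \qquad \begin{pmatrix} q_{1} \\ q_{1}' \\ q_{1}'' \\ q_{1}''' \end{pmatrix}=\begin{pmatrix} w \\ x \\ y \\ z \end{pmatrix}.$$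
   Context: The ring of quaternions over $\mathbf{R}$ is $\mathcal{H}_{\mathbf{R}}=\{ w+xi+yj+zk \mid w,x,y,z\in \mathbf{R}\}$ (the free $\mathbf{R}$-module with basis $1,i,j,k$), with componentwise addition and $\mathbf{R}$-bilinear multiplication determined by the identity $1$ and the rules $i^{2}=j^{2}=k^{2}=-1$, $ij=k$, $jk=i$, $ki=j$, $ji=-k$, $kj=-i$, $ik=-j$. $U(\mathcal{H}_{\mathbf{R}})$ denotes the group of units of $\mathcal{H}_{\mathbf{R}}$. *)

(* Defs.v *)
From HB Require Import structures.
From mathcomp Require Import all_boot all_order all_algebra.
From mathcomp Require Import ring.

Set Implicit Arguments.
Unset Strict Implicit.
Unset Printing Implicit Defensive.

Import GRing.Theory.
Local Open Scope ring_scope.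

(* [Quat w x y z] stands for w + x i + y j + z k, see [quatE]. *)
Record quat (R : Type) := Quat { quat1 : R; quati : R; quatj : R; quatk : R }.

Definition tuple_of_quat R (q : quat R) : R * R * R * R :=
  (quat1 q, quati q, quatj q, quatk q).
Definition quat_of_tuple R (t : R * R * R * R) : quat R :=
  let: (w, x, y, z) := t in Quat w x y z.
Lemma tuple_of_quatK R : cancel (@tuple_of_quat R) (@quat_of_tuple R).
Proof. by case. Qed.

HB.instance Definition _ (R : eqType) :=
  Equality.copy (quat R) (can_type (@tuple_of_quatK R)).
HB.instance Definition _ (R : choiceType) :=
  Choice.copy (quat R) (can_type (@tuple_of_quatK R)).
HB.instance Definition _ (R : countType) :=
  Countable.copy (quat R) (can_type (@tuple_of_quatK R)).
HB.instance Definition _ (R : finType) :=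
  Finite.copy (quat R) (can_type (@tuple_of_quatK R)).

Section QuatRing.
Variable R : comPzRingType.
Implicit Types (a : R) (p q r : quat R).

Definition quat_zero : quat R := Quat 0 0 0 0.
Definition quat_add p q : quat R :=
  let: Quat a b c d := p in let: Quat w x y z := q in
  Quat (a + w) (b + x) (c + y) (d + z).
Definition quat_opp q : quat R :=
  let: Quat w x y z := q in Quat (- w) (- x) (- y) (- z).

Lemma quat_addA : associative quat_add.
Proof. by move=> [a b c d] [e f g h] [w x y z] /=; rewrite !addrA. Qed.
Lemma quat_addC : commutative quat_add.
Proof. by move=> [a b c d] [w x y z] /=; congr Quat; rewrite addrC. Qed.
Lemma quat_add0 : left_id quat_zero quat_add.
Proof. by move=> [w x y z] /=; rewrite !add0r. Qed.
Lemma quat_addN : left_inverse quat_zero quat_opp quat_add.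
Proof. by move=> [w x y z] /=; rewrite !addNr. Qed.

HB.instance Definition _ := GRing.isZmodule.Build (quat R)
  quat_addA quat_addC quat_add0 quat_addN.

Definition quat_one : quat R := Quat 1 0 0 0.

(* The bilinear product with unit 1 such that i^2 = j^2 = k^2 = -1, ij = k,
   jk = i, ki = j, ji = -k, kj = -i, ik = -j; see [quat_mul_table]. *)
Definition quat_mul p q : quat R :=
  let: Quat a b c d := p in let: Quat w x y z := q in
  Quat (a * w - b * x - c * y - d * z)
       (a * x + b * w + c * z - d * y)
       (a * y - b * z + c * w + d * x)
       (a * z + b * y - c * x + d * w).

Lemma quat_mulA : associative quat_mul.
Proof. by move=> [a b c d] [e f g h] [w x y z] /=; congr Quat; ring. Qed.
Lemma quat_mul1q : left_id quat_one quat_mul.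
Proof. by move=> [w x y z] /=; congr Quat; ring. Qed.
Lemma quat_mulq1 : right_id quat_one quat_mul.
Proof. by move=> [w x y z] /=; congr Quat; ring. Qed.
Lemma quat_mulDl : left_distributive quat_mul +%R.
Proof. by move=> [a b c d] [e f g h] [w x y z]; congr Quat; ring. Qed.
Lemma quat_mulDr : right_distributive quat_mul +%R.
Proof. by move=> [a b c d] [e f g h] [w x y z]; congr Quat; ring. Qed.

HB.instance Definition _ := GRing.Zmodule_isPzRing.Build (quat R)
  quat_mulA quat_mul1q quat_mulq1 quat_mulDl quat_mulDr.

Definition quat_scale a q : quat R :=
  let: Quat w x y z := q in Quat (a * w) (a * x) (a * y) (a * z).

Lemma quat_scaleA a b q : quat_scale a (quat_scale b q) = quat_scale (a * b) q.
Proof. by case: q => w x y z /=; rewrite !mulrA. Qed.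
Lemma quat_scale1 : left_id 1 quat_scale.
Proof. by move=> [w x y z] /=; rewrite !mul1r. Qed.
Lemma quat_scaleDr : right_distributive quat_scale +%R.
Proof. by move=> a [b c d e] [w x y z]; congr Quat; rewrite mulrDr. Qed.
Lemma quat_scaleDl q : {morph quat_scale^~ q : a b / a + b}.
Proof. by case: q => w x y z a b; congr Quat; rewrite mulrDl. Qed.

HB.instance Definition _ := GRing.Zmodule_isLmodule.Build R (quat R)
  quat_scaleA quat_scale1 quat_scaleDr quat_scaleDl.

Lemma quat_scaleAl a p q : a *: (p * q) = (a *: p) * q.
Proof. by case: p q => [b c d e] [w x y z]; congr Quat; ring. Qed.
Lemma quat_scaleAr a p q : a *: (p * q) = p * (a *: q).
Proof. by case: p q => [b c d e] [w x y z]; congr Quat; ring. Qed.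

Definition qi : quat R := Quat 0 1 0 0.
Definition qj : quat R := Quat 0 0 1 0.
Definition qk : quat R := Quat 0 0 0 1.

Lemma quatE w x y z : Quat w x y z = w *: (1 : quat R) + x *: qi + y *: qj + z *: qk.
Proof. by congr Quat; rewrite /=; ring. Qed.

Lemma quat_mul_table :
  [/\ [/\ qi ^+ 2 = -1, qj ^+ 2 = -1 & qk ^+ 2 = -1],
      [/\ qi * qj = qk, qj * qk = qi & qk * qi = qj] &
      [/\ qj * qi = - qk, qk * qj = - qi & qi * qk = - qj]].
Proof. by do ![split]; congr Quat; rewrite /=; ring. Qed.

End QuatRing.

Arguments qi {R}.
Arguments qj {R}.
Arguments qk {R}.

(* Two-sided invertibility as in [unitrP]; [GRing.unit] itself requires 1 != 0,
   which fails for the quaternions over the zero ring. *)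
Definition is_unit (A : pzRingType) (q : A) : Prop :=
  exists p : A, p * q = 1 /\ q * p = 1.

Definition rows_mx (R : pzRingType) m n (rows : seq (seq R)) : 'M[R]_(m, n) :=
  \matrix_(i < m, j < n) (nth [::] rows i)`_j.

(* Main.v *)
Require Import Defs.
From HB Require Import structures.
From mathcomp Require Import all_boot all_order all_algebra.
From mathcomp Require Import ring.

Import GRing.Theory.
Local Open Scope ring_scope.

(** A quaternion of finite order s has q ^+ s.-1 as inverse. Conversely, over a
    finite R the ring of quaternions is finite, so two powers of q with
    different exponents agree ([finite_exp_collision]); if q is invertible, the
    smaller power cancels from that equation ([unit_expr_cancel]) and a positive
    power of q is 1. Neither direction uses anything about quaternions beyond
    finiteness, and [is_unit_finite_order] holds in any finite ring, the zero
    ring included.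

    The 4 x 4 matrix of the recurrence is the matrix of multiplication by
    q = w + x i + y j + z k on the right, in the basis 1, i, j, k
    ([rmul_mx_coord]); for multiplication on the left, the lower right
    3 x 3 block would be transposed. The recurrence therefore says that the
    quaternion with coordinates q_s is the one with coordinates q_(s-1) times q,
    which is the recurrence of the powers q ^+ s = q ^+ (s-1) * q
    ([quat_exp_recurrence]). *)

(** * Units of a finite ring *)

Lemma expr_eq1_unit {A : pzRingType} (q : A) (s : nat) :
  (0 < s)%N -> q ^+ s = 1 -> is_unit q.
Proof.
by case: s => // s _ qs1; exists (q ^+ s); rewrite -exprS -exprSr.
Qed.

(** A left inverse of q strips the common factor q ^+ m one q at a time. *)
Lemma unit_expr_cancel {A : pzRingType} (q : A) (m n : nat) :
  is_unit q -> q ^+ m = q ^+ (m + n) -> q ^+ n = 1.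
Proof.
case=> p [pq1 _].
elim: m => [|m IHm]; first by rewrite add0n expr0 => ->.
rewrite addSn !exprS => eq_q; apply: IHm.
by rewrite -[LHS]mul1r -[RHS]mul1r -pq1 -!mulrA eq_q.
Qed.

(** Pigeonhole: #|A| + 1 exponents have at most #|A| powers. *)
Lemma finite_exp_collision {A : finPzRingType} (q : A) :
  exists m n : nat, (0 < n)%N /\ q ^+ m = q ^+ (m + n).
Proof.
pose f (i : 'I_#|A|.+1) := q ^+ i.
have /injectivePn [i [j neq_ij eq_f]] : ~~ injectiveb f.
  by apply/injectiveP => /leq_card; rewrite card_ord ltnn.
wlog lt_ij : i j neq_ij eq_f / (i < j)%N => [hwlog|].
  have : (i != j :> nat) := neq_ij.
  rewrite neq_ltn => /orP [] lt; first exact: (hwlog i j).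
  by apply: (hwlog j i) => //; rewrite eq_sym.
exists i, (j - i)%N; split; first by rewrite subn_gt0.
by rewrite subnKC // ltnW.
Qed.

Lemma is_unit_finite_order {A : finPzRingType} (q : A) :
  is_unit q <-> exists s : nat, (0 < s)%N /\ q ^+ s = 1.
Proof.
split=> [Uq | [s [s_gt0 /expr_eq1_unit]]]; last exact.
have [m [n [n_gt0 eq_q]]] := finite_exp_collision q.
by exists n; split=> //; apply: unit_expr_cancel eq_q.
Qed.

(** Joins the finite and the ring structure of the quaternions, so that the
    results on finite rings apply to them. *)
HB.instance Definition _ (R : finComPzRingType) := Finite.on (quat R).

(** * Right multiplication in coordinates *)

Definition quat_col {R : pzRingType} (p : quat R) : 'cV[R]_4 :=
  rows_mx 4 1 [:: [:: quat1 p]; [:: quati p]; [:: quatj p]; [:: quatk p]].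

Lemma quat_col_inj {R : pzRingType} : injective (@quat_col R).
Proof.
move=> [a b c d] [w x y z] /matrixP eq_col.
have eq_row (i : 'I_4) := eq_col i 0.
have := (eq_row 0, eq_row 1, eq_row 2, eq_row 3).
by rewrite !mxE /= => -[[[-> ->] ->] ->].
Qed.

Definition rmul_mx {R : pzRingType} (p : quat R) : 'M[R]_4 :=
  let: Quat w x y z := p in
  rows_mx 4 4 [:: [:: w; - x; - y; - z];
                  [:: x;   w;   z; - y];
                  [:: y; - z;   w;   x];
                  [:: z;   y; - x;   w]].

(** The first column of the matrix is p itself; the other columns are i * p,
    j * p and k * p. *)
Lemma rmul_mx_coord {R : comPzRingType} (p r : quat R) :
  rmul_mx p *m quat_col r = quat_col (r * p).
Proof.
case: p r => [w x y z] [a b c d].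
apply/matrixP => i j; rewrite !mxE !big_ord_recl big_ord0 !mxE (ord1 j).
by case: i => [[|[|[|[|//]]]] lt_i] /=; ring.
Qed.

(** Coordinates determine a quaternion, so the recurrence on columns is the
    equation r s = r (s - 1) * p, satisfied by the powers of p. *)
Lemma quat_exp_recurrence {R : comPzRingType} (p : quat R) (r : nat -> quat R) :
  quat_col (r 1%N) = quat_col p ->
  (forall s, (2 <= s)%N ->
     quat_col (r s) = rmul_mx p *m quat_col (r (s - 1)%N)) ->
  forall s, (1 <= s)%N -> p ^+ s = r s.
Proof.
move=> /quat_col_inj r1 rS; case=> // s _.
elim: s => [|s IHs]; first by rewrite expr1 r1.
by apply: quat_col_inj; rewrite rS // subn1 rmul_mx_coord -IHs exprSr.
Qed.

Theorem theorem4 (R : finComPzRingType) :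
  (forall q : quat R,
     is_unit q <-> exists s : nat, (0 < s)%N /\ q ^+ s = 1) /\
  (forall (w x y z : R) (q q' q'' q''' : nat -> R),
     let col s : 'cV[R]_4 :=
       rows_mx 4 1 [:: [:: q s]; [:: q' s]; [:: q'' s]; [:: q''' s]] in
     col 1%N = rows_mx 4 1 [:: [:: w]; [:: x]; [:: y]; [:: z]] ->
     (forall s : nat, (2 <= s)%N ->
        col s = rows_mx 4 4 [:: [:: w; - x; - y; - z];
                                [:: x;   w;   z; - y];
                                [:: y; - z;   w;   x];
                                [:: z;   y; - x;   w]] *m col (s - 1)%N) ->
     forall s : nat, (1 <= s)%N ->
       (w *: (1 : quat R) + x *: qi + y *: qj + z *: qk) ^+ s
       = q s *: (1 : quat R) + q' s *: qi + q'' s *: qj + q''' s *: qk).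
Proof.
split=> [q | w x y z q q' q'' q''' col col1 colS s s_gt0].
  exact: is_unit_finite_order.
rewrite -!quatE.
exact: (@quat_exp_recurrence R (Quat w x y z)
          (fun s => Quat (q s) (q' s) (q'' s) (q''' s))).
Qed.
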